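(* Let $G$ be a finite simple connected graph with $|E(G)|>\nu_2(G)$ and $\nu_2(G)\ge 5$. If $\gamma(G)=\nu_2(G)-1$, then $G$ is isomorphic to $T^{\nu_2(G)}_{s,t}$ for some positive integers $s,t$ with $s+4=\nu_2(G)$.
   Context: A 2-packing of a graph $G$ is a set $R\subseteq E(G)$ such that no three edges of $R$ are incident with a common vertex; $\nu_2(G)$ is the maximum size of a 2-packing. $\gamma(G)$ is the domination number: the minimum size of a set $D\subseteq V(G)$ such that every vertex is in $D$ or adjacent to a vertex of $D$. For positive integers $s,t$ and $r=s+4$, $T^{r}_{s,t}$ is the tree with vertex set $\{v_0,\ldots,v_4\}\cup\{p_1,\ldots,p_s\}\cup\{q_1,\ldots,q_s\}\cup\{w_1,\ldots,w_t\}$ (all distinct) and edge set $\{v_0v_1,v_1v_2,v_2v_3,v_3v_4\}\cup\{p_iq_i:1\le i\le s\}\cup\{v_2w_i:1\le i\le t\}\cup\{v_2p_i:1\le i\le s\}$. *)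

(* Defs.v *)
From HB Require Import structures.
From mathcomp Require Import all_boot.

Set Implicit Arguments.
Unset Strict Implicit.
Unset Printing Implicit Defensive.

Record sgraph := SGraph {
  svertex :> finType;
  sedge : rel svertex;
  sedge_sym : symmetric sedge;
  sedge_irrefl : irreflexive sedge
}.

Definition connected_graph (G : sgraph) : Prop :=
  0 < #|G| /\ forall x y : G, connect (@sedge G) x y.

Definition edges (G : sgraph) : {set {set G}} :=
  [set [set p.1; p.2] | p in [set p : G * G | sedge p.1 p.2]].

Definition two_packing (G : sgraph) (R : {set {set G}}) : bool :=
  (R \subset edges G) && [forall v : G, #|[set f in R | v \in f]| <= 2].

Definition nu2 (G : sgraph) : nat :=
  \max_(R : {set {set G}} | two_packing R) #|R|.

Definition dominating (G : sgraph) (D : {set G}) : bool :=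
  [forall v : G, (v \in D) || [exists u in D, sedge v u]].

(* The default value setT is itself dominating, so this is a true minimum. *)
Definition gamma (G : sgraph) : nat :=
  #|[arg min_(D < [set: G] | dominating D) #|D|]|.

Definition graph_iso (G H : sgraph) : Prop :=
  exists f : G -> H,
    bijective f /\ forall x y : G, sedge (f x) (f y) = sedge x y.

(* The four summands carry, in order, the v_i (0 <= i <= 4), the p_i, the q_i
   (indexed from 0, i < s) and the w_i (indexed from 0, i < t). *)
Definition tree_vertex (s t : nat) : finType :=
  ('I_5 + ('I_s + ('I_s + 'I_t)))%type.

Notation tree_v i := (inl i) (only parsing).
Notation tree_p i := (inr (inl i)) (only parsing).
Notation tree_q i := (inr (inr (inl i))) (only parsing).
Notation tree_w i := (inr (inr (inr i))) (only parsing).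

(* Each edge in one orientation only; tree_rel symmetrizes. *)
Definition tree_arc (s t : nat) (x y : tree_vertex s t) : bool :=
  match x, y with
  | tree_v i, tree_v j => nat_of_ord j == i.+1
  | tree_p i, tree_q j => i == j
  | tree_v i, tree_w _ => nat_of_ord i == 2
  | tree_v i, tree_p _ => nat_of_ord i == 2
  | _, _ => false
  end.

Definition tree_rel (s t : nat) : rel (tree_vertex s t) :=
  fun x y => tree_arc x y || tree_arc y x.

Lemma tree_rel_sym (s t : nat) : symmetric (@tree_rel s t).
Proof. by move=> x y; rewrite /tree_rel orbC. Qed.

Lemma tree_rel_irrefl (s t : nat) : irreflexive (@tree_rel s t).
Proof.
move=> x; rewrite /tree_rel orbb.
by case: x => [i|[i|[i|i]]] //=; rewrite ltn_eqF.
Qed.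

(* T^r_{s,t}; the superscript r = s + 4 is determined by s. *)
Definition T_graph (s t : nat) : sgraph :=
  SGraph (@tree_rel_sym s t) (@tree_rel_irrefl s t).

(* Main.v *)
(** The edges of a matching and those of a second, disjoint one form a
    2-packing.  A maximum matching M has at least gamma G edges: picking a
    suitable end of each edge dominates, since otherwise there is an augmenting
    path with three edges.  Hence nu2 G = |M| + 1, and the edges outside M
    pairwise meet.  As |M| >= 4, connectedness forces them to share a vertex c,
    and c is covered by an edge ec of M, for otherwise two edges at c could be
    added to M.  Finally c together with its non-neighbours is dominating, so
    every edge of M other than ec contains a non-neighbour of c; this makes G a
    spider with center c. *)

Require Import Defs.
From mathcomp Require Import all_boot.

Set Implicit Arguments.
Unset Strict Implicit.
Unset Printing Implicit Defensive.

(** * Edges as two-element sets, and the extremal properties of [gamma] and [nu2] *)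

Lemma edgesP (G : sgraph) (e : {set G}) :
  reflect (exists x y : G, sedge x y /\ e = [set x; y]) (e \in edges G).
Proof.
apply: (iffP imsetP) => [[[x y]]|[x [y [xy ->]]]].
  by rewrite inE /= => xy ->; exists x, y.
by exists (x, y); rewrite ?inE.
Qed.

Lemma sedge_neq (G : sgraph) (x y : G) : sedge x y -> x != y.
Proof. by apply: contraTneq => ->; rewrite sedge_irrefl. Qed.

Lemma edges_eq (G : sgraph) (e : {set G}) (x y : G) :
  e \in edges G -> x \in e -> y \in e -> x != y -> e = [set x; y].
Proof.
case/edgesP=> p [q [_ ->]]; rewrite !inE.
by case/orP=> /eqP-> /orP[]/eqP->; rewrite ?eqxx // setUC.
Qed.

Lemma mem_edges (G : sgraph) (x y : G) :
  ([set x; y] \in edges G) = sedge x y.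
Proof.
apply/edgesP/idP => [[p [q [pq e]]]|xy]; last by exists x, y.
have: p \in [set x; y] by rewrite e set21.
have: q \in [set x; y] by rewrite e set22.
have := sedge_neq pq.
by rewrite !inE => + /orP[]/eqP eq /orP[]/eqP ep; move: pq;
  rewrite eq ep ?eqxx // sedge_sym.
Qed.

Lemma edges_other (G : sgraph) (e : {set G}) (x : G) :
  e \in edges G -> x \in e -> exists2 y, sedge x y & e = [set x; y].
Proof.
case/edgesP=> p [q [pq ->]]; rewrite !inE => /orP[]/eqP->.
  by exists q.
by exists p; rewrite 1?sedge_sym // setUC.
Qed.

Lemma gamma_min (G : sgraph) (D : {set G}) : dominating D -> gamma G <= #|D|.
Proof.
rewrite /gamma; case: arg_minnP => [|D0 _ minD]; last exact: minD.
by apply/forallP => v; rewrite inE.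
Qed.

Lemma nu2_max (G : sgraph) (R : {set {set G}}) : two_packing R -> #|R| <= nu2 G.
Proof. by move=> packR; rewrite /nu2 (bigD1 R) //= leq_maxl. Qed.

(** * Matchings *)

Definition matching (G : sgraph) (M : {set {set G}}) : bool :=
  (M \subset edges G) && trivIset M.

Lemma matching_edge (G : sgraph) (M : {set {set G}}) (e : {set G}) :
  matching M -> e \in M -> e \in edges G.
Proof. by case/andP=> /subsetP sME _ /sME. Qed.

Lemma matching_set0 (G : sgraph) (M : {set {set G}}) :
  matching M -> set0 \notin M.
Proof.
move=> matM; apply/negP => /(matching_edge matM) /edgesP[x [y [_ e]]].
by have := set21 x y; rewrite -e inE.
Qed.

Lemma matching_eq (G : sgraph) (M : {set {set G}}) (e f : {set G}) (x : G) :
  matching M -> e \in M -> f \in M -> x \in e -> x \in f -> e = f.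
Proof.
case/andP=> _ /trivIsetP tM eM fM xe xf.
apply/eqP/negPn/negP => /(tM _ _ eM fM) /pred0P/(_ x) /=.
by rewrite xe xf.
Qed.

Lemma matching_mate (G : sgraph) (M : {set {set G}}) (x y z : G) :
  matching M -> [set x; y] \in M -> [set x; z] \in M -> y = z.
Proof.
move=> matM xy xz.
have e := matching_eq (x := x) matM xy xz (set21 _ _) (set21 _ _).
have := set22 x y; rewrite e !inE => /orP[]/eqP // yx.
by have := matching_edge matM xy; rewrite mem_edges yx sedge_irrefl.
Qed.

Lemma matchingU1 (G : sgraph) (M : {set {set G}}) (e : {set G}) :
  matching M -> e \in edges G -> (forall f, f \in M -> [disjoint e & f]) ->
  matching (e |: M) /\ #|e |: M| = #|M|.+1.
Proof.
move=> matM eE dis; have /andP[sM tM] := matM.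
have [tU eM] := trivIsetU1 dis tM (matching_set0 matM).
by rewrite /matching tU subUset sub1set eE sM cardsU1 eM.
Qed.

Lemma matchingS (G : sgraph) (M N : {set {set G}}) :
  N \subset M -> matching M -> matching N.
Proof.
by move=> sNM /andP[sM tM]; rewrite /matching (subset_trans sNM sM) (trivIsetS sNM).
Qed.

Lemma disjoint_pair (T : finType) (x y : T) (A : {set T}) :
  x \notin A -> y \notin A -> [disjoint [set x; y] & A].
Proof.
move=> xA yA; apply/pred0P => z /=; rewrite !inE.
by case: eqP => [->|_]; [rewrite (negPf xA) | case: eqP => [->|//]; rewrite (negPf yA)].
Qed.

(** * Domination by ends of a maximum matching *)

(** Each edge [e] of a maximum matching has an end [r e] adjacent to every uncovered vertex that
    either end sees. These ends dominate: a covered vertex lies on some [e] together with [r e], and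
    an uncovered vertex has a neighbour, which is covered by maximality. *)
Lemma gamma_le_matching (G : sgraph) :
  (forall x : G, exists y, sedge x y) ->
  exists2 M : {set {set G}}, matching M & gamma G <= #|M|.
Proof.
move=> noiso.
(* The empty graph is treated apart because [x0] serves below as the value of [r] outside [M]. *)
case: (pickP (@predT G)) => [x0 _|G0]; last first.
  exists set0; first by rewrite /matching sub0set /trivIset /cover !big_set0 cards0.
  suff <-: #|[set: G]| = #|@set0 {set G}|.
    by apply: gamma_min; apply/forallP => v; rewrite inE.
  by rewrite cardsT cards0; apply: eq_card0.
have mat0 : @matching G set0.
  by rewrite /matching sub0set /trivIset /cover !big_set0 cards0.
case: (@arg_maxnP _ set0 (@matching G) (fun M => #|M|) mat0) => M matM maxM.
have freeP u e : u \notin cover M -> e \in M -> u \notin e.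
  by move=> uM eM; apply: contra uM => ue; apply/bigcupP; exists e.
have rep e : exists r, e \in M ->
    r \in e /\ forall x u, x \in e -> u \notin cover M -> sedge x u -> sedge r u.
  have [eM|] := boolP (e \in M); last by exists x0.
  have /edgesP[x [y [xy ee]]] := matching_edge matM eM.
  have [/existsP[u /andP[uM xu]]|nox] :=
      boolP [exists u, (u \notin cover M) && sedge x u]; last first.
    exists y => _; split=> [|z u]; first by rewrite ee set22.
    rewrite ee !inE => /orP[]/eqP-> uM // xu.
    by case/negP: nox; apply/existsP; exists u; rewrite uM.
  exists x => _; split=> [|z u']; first by rewrite ee set21.
  rewrite ee !inE => /orP[]/eqP-> u'M // yu'.
  (* If [u] and [u'] differ, then [u], [x], [y], [u'] is an augmenting path: replacing [e] by the
     edges [yu'] and [xu] contradicts maximality. *)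
  have [<-//|uu'] := eqVneq u u'.
  have matN : matching (M :\ e) := matchingS (subD1set _ _) matM.
  have notin w f : w \in e -> f \in M :\ e -> w \notin f.
    move=> we /setD1P[fe fM]; apply: contra fe => wf.
    by apply/eqP; apply: matching_eq matM fM eM wf we.
  have [|f fN|mat1 card1] := @matchingU1 _ _ [set y; u'] matN;
      first by rewrite mem_edges.
    apply: disjoint_pair; first by apply: notin fN; rewrite ee set22.
    by apply: freeP => //; case/setD1P: fN.
  have [|f fN|mat2 card2] := @matchingU1 _ _ [set x; u] mat1;
      first by rewrite mem_edges.
    have xM : x \in cover M by apply/bigcupP; exists e; rewrite // ee set21.
    have yM : y \in cover M by apply/bigcupP; exists e; rewrite // ee set22.
    case/setU1P: fN => [->|fN]; apply: disjoint_pair.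
    - rewrite !inE negb_or (sedge_neq xy) /=.
      by apply: contraNneq u'M => <-.
    - rewrite !inE negb_or uu' andbT.
      by apply: contraNneq uM => ->.
    - by apply: notin fN; rewrite ee set21.
    - by apply: freeP => //; case/setD1P: fN.
  have := maxM _ mat2; rewrite card2 card1 (cardsD1 e M) eM add1n.
  by rewrite /= ltnn.
have [r rP] := fin_all_exists rep.
exists M => //; apply: leq_trans (leq_imset_card r M).
apply: gamma_min; apply/forallP => v.
have [/bigcupP[e eM ve]|vM] := boolP (v \in cover M).
  have [re _] := rP e eM.
  have [<-|rv] := eqVneq (r e) v; first by rewrite imset_f.
  apply/orP; right; apply/existsP; exists (r e); rewrite imset_f //=.
  have eE := matching_edge matM eM.
  by rewrite -mem_edges -(edges_eq eE ve re) // eq_sym.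
have [x vx] := noiso v.
have [/bigcupP[e eM xe]|xM] := boolP (x \in cover M); last first.
  have [|f fM|mat1 card1] := @matchingU1 _ _ [set v; x] matM;
      first by rewrite mem_edges.
    by apply: disjoint_pair; apply: freeP.
  by have := maxM _ mat1; rewrite /= card1 ltnn.
have [_ rv] := rP e eM.
apply/orP; right; apply/existsP; exists (r e); rewrite imset_f //=.
by rewrite sedge_sym; apply: rv xe vM _; rewrite sedge_sym.
Qed.

(** * 2-packings obtained by adding edges to a matching *)

Lemma card_incident (G : sgraph) (R : {set {set G}}) (v : G) :
  #|[set f in R | v \in f]| = \sum_(f in R) (v \in f).
Proof. by rewrite -sum1dep_card big_mkcondr; apply: eq_bigr => f _; case: ifP. Qed.

(** The bound is sharper than 1: it vanishes at uncovered vertices, where room is left for two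
    further edges. *)
Lemma matching_degree (G : sgraph) (M : {set {set G}}) (v : G) :
  matching M -> \sum_(f in M) (v \in f) <= (v \in cover M).
Proof.
move=> matM; rewrite -card_incident.
have [vM|vM] := boolP (v \in cover M).
  apply/card_le1_eqP => e f; rewrite !inE => /andP[eM ve] /andP[fM vf].
  exact: matching_eq matM fM eM vf ve.
rewrite leqn0 cards_eq0; apply/eqP/setP => f; rewrite !inE.
by apply: contraNF vM => /andP[fM vf]; apply/bigcupP; exists f.
Qed.

Lemma nu2_add1 (G : sgraph) (M : {set {set G}}) (e : {set G}) :
  matching M -> e \in edges G :\: M -> #|M| < nu2 G.
Proof.
move=> matM /setDP[eE eM].
have <-: #|e |: M| = #|M|.+1 by rewrite cardsU1 eM.
apply: nu2_max; rewrite /two_packing subUset sub1set eE.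
have /andP[-> _] := matM; apply/forallP => v.
rewrite card_incident big_setU1 //= (leq_add (leq_b1 _)) //.
by rewrite (leq_trans (matching_degree _ matM)) ?leq_b1.
Qed.

(** A common vertex of [e] and [f] lies on no edge of [M], and every other vertex lies on at most
    one of the two new edges, so no vertex gets three edges. It is applied to disjoint edges and to
    two edges meeting in an uncovered vertex. *)
Lemma nu2_add2 (G : sgraph) (M : {set {set G}}) (e f : {set G}) :
  matching M -> e \in edges G :\: M -> f \in edges G :\: M -> e != f ->
  (forall v, v \in e -> v \in f -> v \notin cover M) -> #|M|.+1 < nu2 G.
Proof.
move=> matM /setDP[eE eM] /setDP[fE fM] ef cap.
have eN : e \notin f |: M by rewrite !inE negb_or ef.
have <-: #|e |: (f |: M)| = #|M|.+2 by rewrite !cardsU1 eN fM.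
apply: nu2_max; rewrite /two_packing !subUset !sub1set eE fE.
have /andP[-> _] := matM; apply/forallP => v.
rewrite card_incident !big_setU1 //=.
apply: leq_trans (leq_add (leqnn _) (leq_add (leqnn _) (matching_degree v matM))) _.
by case ve: (v \in e); case vf: (v \in f);
  rewrite ?(negPf (cap v ve vf)) //; case: (v \in cover M).
Qed.

(** * The common vertex of the edges outside the matching *)

(** Otherwise [e] is closed under adjacency, so by connectedness it contains all vertices, in
    particular those of [f]. *)
Lemma connected_edge_leaving (G : sgraph) (M : {set {set G}}) (e f : {set G}) :
  connected_graph G -> matching M -> e \in M -> f \in M -> e != f ->
  exists2 h, h \in edges G :\: M & ~~ [disjoint e & h].
Proof.
move=> [_ conn] matM eM fM ef.
apply/exists_inP; apply: contraR ef; rewrite negb_exists_in => /forall_inP noh.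
have /edgesP[x [x' [_ ex]]] := matching_edge matM eM.
have /edgesP[y [y' [_ fy]]] := matching_edge matM fM.
have clo : closed (@sedge G) (mem e).
  apply: intro_closed => [|u v uv ue].
    by apply: sym_connect_sym => u v; rewrite sedge_sym.
  have [uvM|uvM] := boolP ([set u; v] \in M).
    by rewrite (matching_eq (x := u) matM eM uvM) // ?set21 ?set22.
  have /noh/negPn/pred0P/(_ u) : [set u; v] \in edges G :\: M.
    by rewrite inE uvM mem_edges.
  by rewrite /= !inE eqxx andbT => /negP[].
have := closed_connect clo (conn x y).
rewrite {1}ex set21 => /esym ye.
by apply/eqP; apply: matching_eq matM eM fM ye _; rewrite fy set21.
Qed.

(** Fix an edge [h] outside [M] and two edges of [M] disjoint from [h]. Each of these two is joined
    to [h] by an edge outside [M]; since the joining edges meet, they do so at an end [c] of [h]. *)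
Lemma star_center (G : sgraph) (M : {set {set G}}) :
  connected_graph G -> matching M -> 4 <= #|M| -> nu2 G = #|M|.+1 ->
  M \proper edges G ->
  exists2 c, c \in cover M & forall f, f \in edges G :\: M -> c \in f.
Proof.
move=> conn matM M4 nuM /properP[_ [h hE hM]].
have cross f g : f \in edges G :\: M -> g \in edges G :\: M ->
    exists2 x, x \in f & x \in g.
  move=> fE gE; apply/exists_inP; apply: contraT; rewrite negb_exists_in.
  move=> /forall_inP nofg.
  have /edgesP[x [y [xy fxy]]] : f \in edges G by case/setDP: fE.
  suff: #|M|.+1 < nu2 G by rewrite nuM ltnn.
  apply: (nu2_add2 matM fE gE) => [|v vf vg]; last by have := nofg v vf; rewrite vg.
  by apply/eqP => efg; have := nofg x; rewrite -efg fxy set21 => /(_ isT).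
have {}hE : h \in edges G :\: M by rewrite inE hM.
have /edgesP[p [q [pq hpq]]] : h \in edges G by case/setDP: hE.
pose S := [set e in M | [disjoint e & h]].
have [e1 [e2 [e1S e2S e12]]] : exists e1 e2, [/\ e1 \in S, e2 \in S & e1 != e2].
  suff /card_gt1P [e1 [e2 []]] : 1 < #|S| by exists e1, e2.
  (* At most one edge of [M] passes through each end of [h], so at least two of the four or more
     avoid [h]. *)
  rewrite -(ltn_add2l 2) (leq_trans M4) //.
  have le1 z : #|[set f in M | z \in f]| <= 1.
    by rewrite card_incident (leq_trans (matching_degree _ matM)) ?leq_b1.
  have MS : M \subset [set f in M | p \in f] :|: [set f in M | q \in f] :|: S.
    apply/subsetP => f fM; rewrite !inE fM /= hpq disjoint_sym.
    case: (boolP (p \in f)) => //= pf; case: (boolP (q \in f)) => //= qf.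
    exact: disjoint_pair.
  apply: leq_trans (subset_leq_card MS) _.
  apply: leq_trans (leq_card_setU _ _) (leq_add _ (leqnn _)).
  exact: leq_trans (leq_card_setU _ _) (leq_add (le1 p) (le1 q)).
have /setIdP[e1M e1h] := e1S; have /setIdP[e2M e2h] := e2S.
have disj (A B : {set G}) z : [disjoint A & B] -> z \in A -> z \notin B.
  by move=> /pred0P/(_ z)/= + zA; rewrite zA /= => ->.
(* An edge outside [M] that touches [e] must also meet [h], hence joins the two. *)
have ray e e' : e \in M -> e' \in M -> e != e' -> [disjoint e & h] ->
    exists c a, [/\ c \in h, a \in e & [set c; a] \in edges G :\: M].
  move=> eM e'M ee' eh.
  have [f fE] := connected_edge_leaving conn matM eM e'M ee'.
  case/pred0Pn=> a /andP[/= ae af].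
  have [c cf ch] := cross f h fE hE.
  exists c, a; split=> //; rewrite -(edges_eq _ cf af) //; first by case/setDP: fE.
  by apply: contraTneq ch => ->; exact: disj _ _ _ eh ae.
have [c [a1 [ch a1e c1E]]] := ray _ _ e1M e2M e12 e1h.
have [c' [a2 [c'h a2e]]] : exists c' a2,
    [/\ c' \in h, a2 \in e2 & [set c'; a2] \in edges G :\: M].
  by apply: ray e2M e1M _ e2h; rewrite eq_sym.
have ne z (A B : {set G}) : [disjoint A & B] -> a1 \in A -> z \in B -> a1 != z.
  by move=> AB a1A zB; apply: contraTneq zB => <-; exact: disj _ _ _ AB a1A.
have d12 : [disjoint e1 & e2].
  by have /andP[_ /trivIsetP] := matM; apply.
have a12 : a1 != a2 by apply: ne d12 a1e a2e.
have a1c' : a1 != c' by apply: ne e1h a1e c'h.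
have a2c : a2 != c by apply: contraTneq ch => <-; exact: disj _ _ _ e2h a2e.
move=> c2E; have ecc' : c = c'.
  have [z] := cross _ _ c1E c2E; rewrite !inE => /orP[]/eqP-> /orP[]/eqP //.
  - by move=> e; rewrite e eqxx in a2c.
  - by move=> e; rewrite e eqxx in a1c'.
  - by move=> e; rewrite e eqxx in a12.
rewrite -ecc' in c2E.
exists c.
  (* If [c] were uncovered, the edges [ca1] and [ca2], which share only [c], could both be added to
     [M]. *)
  apply: contraT => cM; suff: #|M|.+1 < nu2 G by rewrite nuM ltnn.
  apply: (nu2_add2 matM c1E c2E) => [|v].
    apply/eqP => /setP/(_ a1); rewrite !inE eqxx orbT (negPf a12) orbF.
    by move/esym/eqP => e; have := disj _ _ _ e1h a1e; rewrite e ch.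
  rewrite !inE => /orP[]/eqP-> //; rewrite (negPf a12) orbF => /eqP e.
  by have := disj _ _ _ e1h a1e; rewrite e ch.
(* An edge [f] outside [M] that misses [c] meets [ca1] and [ca2] in [a1] and [a2], so it is [a1a2];
   but that edge is disjoint from [h]. *)
move=> f fE; apply: contraT => cf.
have [d df dh] := cross f h fE hE.
have a1f : a1 \in f.
  by have [z zf] := cross _ _ fE c1E; rewrite !inE => /orP[]/eqP e;
    rewrite e ?(negPf cf) in zf *.
have a2f : a2 \in f.
  by have [z zf] := cross _ _ fE c2E; rewrite !inE => /orP[]/eqP e;
    rewrite e ?(negPf cf) in zf *.
have fe : f = [set a1; a2] by apply: edges_eq a1f a2f a12; case/setDP: fE.
move: df; rewrite fe !inE => /orP[]/eqP e; move: dh; rewrite e.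
  by rewrite (negPf (disj _ _ _ e1h a1e)).
by rewrite (negPf (disj _ _ _ e2h a2e)).
Qed.

(** * Spiders, and their identification with the trees [T_graph] *)

Definition spider_vertex (n t : nat) : finType :=
  option ('I_n + ('I_n + 'I_t)).

(* [None] is the body, the three summands are the knees of the legs of length
   two, their feet, and the legs of length one. *)
Definition spider_arc (n t : nat) (x y : spider_vertex n t) : bool :=
  match x, y with
  | None, Some (inl _) => true
  | None, Some (inr (inr _)) => true
  | Some (inl i), Some (inr (inl j)) => i == j :> nat
  | _, _ => false
  end.

Definition spider_rel (n t : nat) : rel (spider_vertex n t) :=
  fun x y => spider_arc x y || spider_arc y x.

(** The body is [v_2], and the path through [v_0] to [v_4] provides two further legs of length two,
    with knees [v_1], [v_3] and feet [v_0], [v_4]; hence [s.+2] such legs. *)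
Definition tree_spider (s t : nat) (x : tree_vertex s t) :
    spider_vertex s.+2 t :=
  match x with
  | tree_v i =>
    match nat_of_ord i with
    | 0 => Some (inr (inl ord0))
    | 1 => Some (inl ord0)
    | 2 => None
    | 3 => Some (inl (lift ord0 ord0))
    | _ => Some (inr (inl (lift ord0 ord0)))
    end
  | tree_p i => Some (inl (lift ord0 (lift ord0 i)))
  | tree_q i => Some (inr (inl (lift ord0 (lift ord0 i))))
  | tree_w i => Some (inr (inr i))
  end.

Lemma tree_spider_bij (s t : nat) : bijective (@tree_spider s t).
Proof.
apply: inj_card_bij => [x y|]; last first.
  rewrite card_option !card_sum !card_ord.
  by rewrite !addSn !addnS !addnA.
case: x => [[[|[|[|[|[|//]]]]] ?]|[x|[x|x]]];
case: y => [[[|[|[|[|[|//]]]]] ?]|[y|[y|y]]] //=;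
  try (by move=> _; congr inl; apply: val_inj);
  case=> e; first [by rewrite e | by rewrite (val_inj e)].
Qed.

Lemma tree_spider_rel (s t : nat) (x y : tree_vertex s t) :
  spider_rel (tree_spider x) (tree_spider y) = tree_rel x y.
Proof.
rewrite /spider_rel /tree_rel.
case: x => [[[|[|[|[|[|//]]]]] ?]|[x|[x|x]]];
case: y => [[[|[|[|[|[|//]]]]] ?]|[y|[y|y]]] //=.
Qed.

Lemma spider_tree_iso (G : sgraph) (s t : nat) (f : spider_vertex s.+2 t -> G) :
  bijective f -> (forall x y, sedge (f x) (f y) = spider_rel x y) ->
  graph_iso G (T_graph s t).
Proof.
move=> bijf relf.
have [g fK gK] := bij_comp bijf (tree_spider_bij s t).
exists g; split=> [|x y]; first by exists (f \o @tree_spider s t).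
by rewrite /= -tree_spider_rel -relf -[in RHS](gK x) -[in RHS](gK y).
Qed.

(** [B] consists of the feet, [m] sends a foot to its knee, and [W] consists of the ends of the legs
    of length one. The last two hypotheses make these classes, together with [c], exhaust the
    vertices. *)
Lemma spider_embedding (G : sgraph) (c : G) (m : G -> G) (B W : {set G}) :
  {in B &, forall x y, sedge (m x) (m y) = false} ->
  {in B &, forall x y, sedge (m x) y = (x == y)} ->
  {in B &, forall x y, sedge x y = false} ->
  {in B & W, forall x w, sedge (m x) w = false} ->
  {in B & W, forall x w, sedge x w = false} ->
  {in W &, forall v w, sedge v w = false} ->
  {in B, forall x, sedge c (m x)} ->
  (forall x, (x \in B) = (x != c) && ~~ sedge c x) ->
  (forall w, (w \in W) = sedge c w && (w \notin m @: B)) ->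
  exists2 f : spider_vertex #|B| #|W| -> G, bijective f &
    forall x y, sedge (f x) (f y) = spider_rel x y.
Proof.
move=> AA AB BB AW BW WW cA BE WE.
have cB x : x \in B -> sedge c x = false by rewrite BE => /andP[_ /negPf].
have cW w : w \in W -> sedge c w by rewrite WE => /andP[].
pose f (x : spider_vertex #|B| #|W|) : G :=
  match x with
  | None => c
  | Some (inl i) => m (enum_val i)
  | Some (inr (inl i)) => enum_val i
  | Some (inr (inr i)) => enum_val i
  end.
have EB (i : 'I_#|B|) : enum_val i \in B := enum_valP i.
have EW (i : 'I_#|W|) : enum_val i \in W := enum_valP i.
have relf x y : sedge (f x) (f y) = spider_rel x y.
  case: x => [[i|[i|i]]|]; case: y => [[j|[j|j]]|].
  - by rewrite /= AA.
  - by rewrite /= AB // (inj_eq enum_val_inj) /spider_rel /= orbF.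
  - by rewrite /= AW.
  - by rewrite /= sedge_sym cA.
  - by rewrite /= sedge_sym AB // (inj_eq enum_val_inj).
  - by rewrite /= BB.
  - by rewrite /= BW.
  - by rewrite /= sedge_sym cB.
  - by rewrite /= sedge_sym AW.
  - by rewrite /= sedge_sym BW.
  - by rewrite /= WW.
  - by rewrite /= sedge_sym cW.
  - by rewrite /= cA.
  - by rewrite /= cB.
  - by rewrite /= cW.
  - by rewrite /= sedge_irrefl.
have injf : injective f.
  have c_neq v : sedge c v -> v <> c by move=> + e; rewrite e sedge_irrefl.
  have neAB x y : x \in B -> y \in B -> m x <> y.
    by move=> xB /cB + e; rewrite -e cA.
  have neAW x w : x \in B -> w \in W -> m x <> w.
    by move=> xB + e; rewrite -e WE imset_f ?andbF.
  have neBW x w : x \in B -> w \in W -> x <> w.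
    by move=> /cB + /cW + e; rewrite e => ->.
  have neBc x : x \in B -> x <> c by rewrite BE => /andP[/eqP].
  move=> x y; case: x => [[i|[i|i]]|]; case: y => [[j|[j|j]]|] //= e.
  (* Knees of different feet are different, as [m x] is adjacent to no element of [B] but [x]. *)
  - by congr (Some (inl _)); apply/enum_val_inj/eqP; rewrite -AB // e AB.
  - by case: (neAB _ _ _ _ e).
  - by case: (neAW _ _ _ _ e).
  - by case: (c_neq _ _ e); rewrite cA.
  - by case: (neAB _ _ _ _ (esym e)).
  - by rewrite (enum_val_inj e).
  - by case: (neBW _ _ _ _ e).
  - by case: (neBc _ _ e).
  - by case: (neAW _ _ _ _ (esym e)).
  - by case: (neBW _ _ _ _ (esym e)).
  - by rewrite (enum_val_inj e).
  - by case: (c_neq _ _ e); rewrite cW.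
  - by case: (c_neq _ _ (esym e)); rewrite cA.
  - by case: (neBc _ _ (esym e)).
  - by case: (c_neq _ _ (esym e)); rewrite cW.
have surjf y : y \in codom f.
  have [->|yc] := eqVneq y c; first exact: (codom_f f None).
  have [cy|ncy] := boolP (sedge c y); last first.
    have yB : y \in B by rewrite BE yc.
    by rewrite -(enum_rankK_in yB yB); apply: (codom_f f (Some (inr (inl _)))).
  have [/imsetP[x xB ->]|ym] := boolP (y \in m @: B).
    by rewrite -(enum_rankK_in xB xB); apply: (codom_f f (Some (inl _))).
  have yW : y \in W by rewrite WE cy.
  by rewrite -(enum_rankK_in yW yW); apply: (codom_f f (Some (inr (inr _)))).
exists f => //; apply: inj_card_bij (injf) _.
rewrite -(card_codom injf).
by apply/subset_leq_card/subsetP => y _; exact: surjf.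
Qed.

(** * Extremal graphs are spiders *)

Lemma spider_of_extremal (G : sgraph) :
  connected_graph G -> nu2 G < #|edges G| -> 5 <= nu2 G ->
  gamma G = nu2 G - 1 ->
  exists (n t : nat) (f : spider_vertex n t -> G),
    [/\ 0 < t, n + 2 = nu2 G, bijective f
      & forall x y, sedge (f x) (f y) = spider_rel x y].
Proof.
move=> connG nu_lt nu5 gamE; have [_ conn] := connG.
(* By connectedness an isolated vertex would be the only vertex, but [G] has an edge. *)
have noiso (x : G) : exists y, sedge x y.
  apply/existsP; apply: contraT; rewrite negb_exists => /forallP iso_x.
  have x_only y : y = x.
    have clo : closed (@sedge G) (pred1 x).
      apply: intro_closed => [|u v uv /eqP ux].
        by apply: sym_connect_sym => u v; rewrite sedge_sym.
      by have := iso_x v; rewrite -ux uv.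
    by have := closed_connect clo (conn x y); rewrite !inE eqxx => /esym/eqP.
  have /card_gt0P[f] : 0 < #|edges G| by apply: leq_trans nu_lt.
  by case/edgesP=> u [v [uv _]]; rewrite (x_only u) (x_only v) sedge_irrefl in uv.
have [M matM gamM] := gamma_le_matching noiso.
have packM : two_packing M.
  rewrite /two_packing; have /andP[-> _] := matM; apply/forallP => v.
  rewrite card_incident (leq_trans (matching_degree _ matM)) //.
  by case: (v \in _).
have properM : M \proper edges G.
  rewrite properEcard; have /andP[-> _] := matM.
  exact: leq_ltn_trans (nu2_max packM) nu_lt.
have nuM : nu2 G = #|M|.+1.
  apply/eqP; rewrite eqn_leq; apply/andP; split.
    by rewrite -(subnK (ltnW (ltnW (ltnW (ltnW nu5))))) -gamE addn1 ltnS.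
  have /properP[_ [e eE eM]] := properM.
  by apply: (nu2_add1 (e := e) matM); rewrite inE eM.
have M4 : 4 <= #|M| by rewrite -ltnS -nuM.
have [c cM starc] := star_center connG matM M4 nuM properM.
have /bigcupP[ec ecM cec] := cM.
have [c' cc' ecE] := edges_other (matching_edge matM ecM) cec.
have edgeM x y : sedge x y -> x != c -> y != c -> [set x; y] \in M.
  move=> xy xc yc; apply: contraT => xyM.
  have := starc [set x; y]; rewrite !inE xyM mem_edges xy => /(_ isT).
  by rewrite eq_sym (negPf xc) eq_sym (negPf yc).
pose B := [set x | (x != c) && ~~ sedge c x].
(* A neighbour [y] of [x] is not [c], so [xy] is in [M]. Some edge outside [M] touches [xy] and
   contains [c]; as [x] is not adjacent to [c], it is [cy]. Outside [B] the value [c] is a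
   placeholder. *)
have matesP x : exists a, x \in B -> [/\ a != c, sedge c a & [set a; x] \in M].
  have [xB|_] := boolP (x \in B); last by exists c.
  have := xB; rewrite inE => /andP[xc ncx].
  have [y xy] := noiso x.
  have yc : y != c by apply: contraNneq ncx => <-; rewrite sedge_sym.
  have xyM := edgeM _ _ xy xc yc.
  have ne : [set x; y] != ec.
    by apply: contraTneq cec => <-; rewrite !inE negb_or eq_sym xc eq_sym yc.
  have [f fE /pred0Pn[z /andP[/= zxy zf]]] :=
    connected_edge_leaving connG matM xyM ecM ne.
  have cf := starc f fE.
  have fcz : f = [set c; z].
    apply: edges_eq cf zf _; first by case/setDP: fE.
    by apply: contraTneq zxy => <-; rewrite !inE negb_or eq_sym xc eq_sym yc.
  have cz : sedge c z by rewrite -mem_edges -fcz; case/setDP: fE.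
  exists y => _; split=> //; last by rewrite setUC.
  move: zxy; rewrite !inE => /orP[]/eqP e; last by rewrite -e.
  by rewrite e (negPf ncx) in cz.
have [m mP] := fin_all_exists matesP.
have mc x : x \in B -> m x != c by case/mP.
have cm x : x \in B -> sedge c (m x) by case/mP.
have mM x : x \in B -> [set m x; x] \in M by case/mP.
have BN x y : x \in B -> sedge c y -> x != y.
  by rewrite inE => /andP[_ ncx] cy; apply: contraNneq ncx => ->.
have Bc x : x \in B -> x != c by rewrite inE => /andP[].
(* Two legs sharing a vertex are the same edge of [M], and only one end of it, the foot, is a
   non-neighbour of [c]. *)
have B_of_M x y z :
    x \in B -> y \in B -> z \in [set m x; x] -> z \in [set m y; y] -> x = y.
  move=> xB yB zx zy.
  have e := matching_eq matM (mM x xB) (mM y yB) zx zy.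
  have := set22 (m x) x; rewrite e !inE => /orP[]/eqP // xmy.
  by have := BN _ _ xB (cm _ yB); rewrite xmy eqxx.
have legI : {in B &, injective (fun x => [set m x; x])}.
  by move=> x y xB yB e; apply: B_of_M xB yB (set22 _ _) _; rewrite -e set22.
have legM : [set [set m x; x] | x in B] = M :\ ec.
  have sub : [set [set m x; x] | x in B] \subset M :\ ec.
    apply/subsetP => _ /imsetP[x xB ->]; rewrite !inE mM // andbT.
    apply: contraTneq cec => <-.
    by rewrite !inE negb_or eq_sym mc // eq_sym Bc.
  apply/eqP; rewrite eqEcard sub /= card_in_imset //.
  (* This gives [gamma G <= #|B| + 1], while [gamma G = #|M|]; so there are at least as many legs as
     edges in [M :\ ec]. *)
  have domB : dominating (c |: B).
    apply/forallP => v; rewrite !inE.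
    have [//|vc] := eqVneq v c; have [cv|//] := boolP (sedge c v).
    by apply/existsP; exists c; rewrite setU11 sedge_sym.
  have := gamma_min domB; rewrite gamE nuM subn1 /= (cardsD1 ec M) ecM.
  by rewrite cardsU1 !inE eqxx /= leq_add2l.
have cardB : #|B| + 2 = nu2 G.
  by rewrite nuM (cardsD1 ec M) ecM -legM card_in_imset // addnC.
pose W := [set w | sedge c w & w \notin m @: B].
(* The mate of [c] in [M] ends a leg of length one, whence [0 < t]: if it were a knee, [ec] would be
   one of the legs, and these avoid [c]. *)
have c'W : c' \in W.
  rewrite inE cc'; apply/imsetP => -[x xB c'm].
  have e : ec = [set m x; x].
    by apply: matching_eq matM ecM (mM x xB) _ (set21 _ _); rewrite ecE -c'm set22.
  have := cec; rewrite e !inE => /orP[]/eqP cE.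
    by have := mc x xB; rewrite -cE eqxx.
  by have := Bc x xB; rewrite -cE eqxx.
have Wc w : w \in W -> sedge c w by rewrite inE => /andP[].
have Wm w x : w \in W -> x \in B -> w != m x.
  by rewrite inE => /andP[_ wm] xB; apply: contraNneq wm => ->; rewrite imset_f.
have nc v : sedge c v -> v != c by move/sedge_neq; rewrite eq_sym.
have edgeA x z : x \in B -> z != c -> sedge (m x) z -> z = x.
  move=> xB zc e.
  exact: matching_mate matM (edgeM _ _ e (mc x xB) zc) (mM x xB).
have edgeB x z : x \in B -> z != c -> sedge x z -> z = m x.
  move=> xB zc e; apply: matching_mate matM (edgeM _ _ e (Bc x xB) zc) _.
  by rewrite setUC mM.
have [|||||||||f bijf relf] := @spider_embedding _ c m B W.
- move=> x y xB yB; apply: contraTF (BN x _ xB (cm y yB)) => e.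
  by rewrite negbK (edgeA x (m y)) ?mc.
- move=> x y xB yB; apply/idP/eqP => [e|<-]; last first.
    by rewrite -mem_edges (matching_edge matM) ?mM.
  by rewrite (edgeA x y) ?Bc.
- move=> x y xB yB; apply: contraTF (BN y _ yB (cm x xB)) => e.
  by rewrite negbK (edgeB x y) ?Bc.
- move=> x w xB wW; apply: contraTF (BN x _ xB (Wc w wW)) => e.
  by rewrite negbK (edgeA x w) // nc // Wc.
- move=> x w xB wW; apply: contraTF (Wm w x wW xB) => e.
  by rewrite negbK (edgeB x w) // nc // Wc.
(* An edge inside [W] would belong to [M :\ ec], hence have the form [[set m x; x]]; but its end [x]
   is not adjacent to [c]. *)
- move=> v w vW wW; apply: contraTF (cec) => e.
  have /imsetP[x xB vwx] : [set v; w] \in [set [set m x; x] | x in B].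
    rewrite legM !inE edgeM ?nc ?Wc // andbT; apply: contraTneq cec => <-.
    by rewrite !inE negb_or ![c == _]eq_sym !nc ?Wc.
  have := set22 (m x) x; rewrite -vwx !inE => /orP[]/eqP xE.
    by have := BN x v xB (Wc v vW); rewrite xE eqxx.
  by have := BN x w xB (Wc w wW); rewrite xE eqxx.
- exact: cm.
- by move=> x; rewrite inE.
- by move=> w; rewrite inE.
exists #|B|, #|W|, f; split=> //.
by apply/card_gt0P; exists c'.
Qed.

Theorem theorem3p6 (G : sgraph) :
  connected_graph G ->
  nu2 G < #|edges G| ->
  5 <= nu2 G ->
  gamma G = nu2 G - 1 ->
  exists s t : nat,
    [/\ 0 < s, 0 < t, s + 4 = nu2 G & graph_iso G (T_graph s t)].
Proof.
move=> connG nu_lt nu5 gamE.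
have [n [t [f [t0 nE bijf relf]]]] := spider_of_extremal connG nu_lt nu5 gamE.
(* From [n + 2 = nu2 G >= 5] follows [n >= 3]; taking off the two legs of the path leaves
   [s.+1 = n - 2] positive. *)
case: n f nE bijf relf => [|[|[|s]]] f nE bijf relf; try by rewrite -nE in nu5.
exists s.+1, t; split=> //; first by rewrite -nE !addnS !addn0.
exact: spider_tree_iso bijf relf.
Qed.
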